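(* Let $R$ be a regular finitely generated algebra over an $F$-finite regular local ring of characteristic $p>0$. Let $f\in R$ be any element. Then the descending chain of ideals $$I_1(f^{p-1})\supseteq I_2(f^{p^2-1})\supseteq I_3(f^{p^3-1})\supseteq\cdots$$ stabilizes.
   Context: Rings are commutative. A ring $R$ of characteristic $p$ is $F$-finite if it is a finitely generated module over its subring $R^p$ of $p$-th powers; $R^{p^s}$ denotes the subring of $p^s$-th powers. A finitely generated algebra over an $F$-finite ring is $F$-finite. Definition of $I_s(f)$ for an element $f$ of a regular $F$-finite ring $R$ and $s\ge 1$: if $R$ is a free $R^{p^s}$-module, let $\{c_1^{p^s},c_2^{p^s},\dots\}\subset R^{p^s}$ be the coordinates of $f$ with respect to some $R^{p^s}$-basis of $R$; then $I_s(f)$ is the ideal of $R$ generated by $\{c_1,c_2,\dots\}$ (it is independent of the basis). In general, $R$ is a finite locally free $R^p$-module, so $\operatorname{Spec}R$ is covered by finitely many open affines $\operatorname{Spec}R_r$ with $R_r$ free over $R_r^p$ (hence over $R_r^{p^s}$ for every $s$), and $I_s(f)$ is the ideal of $R$ obtained by glueing the ideals $I_s(f)\subseteq R_r$ of the image of $f$ in the $R_r$. *)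

(* Defs.v *)
(* MathComp, with the sets [set T] of MathComp-Analysis' classical layer. *)
From mathcomp Require Import all_boot all_algebra.
From mathcomp Require Import boolp classical_sets.

Set Implicit Arguments.
Unset Strict Implicit.
Unset Printing Implicit Defensive.

Import GRing.Theory.

Local Open Scope classical_set_scope.
Local Open Scope ring_scope.

(* Rings are [comPzRingType]s, so that the zero ring is allowed (a basic
   localization R_r can be zero).  Ideals are [set R]; [idealr] of
   ring_quotient is not used because it only covers proper ideals. *)

Section Ideals.
Variable R : comPzRingType.
Implicit Types (I J P : set R).

Definition is_ideal I : Prop :=
  [/\ I 0, forall a b, I a -> I b -> I (a + b) & forall a b, I b -> I (a * b)].

Definition ideal_gen (n : nat) (x : 'I_n -> R) : set R :=
  [set r | exists a : 'I_n -> R, r = \sum_(i < n) a i * x i].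

Definition prime_ideal P : Prop :=
  [/\ is_ideal P, ~ P 1 & forall a b, P (a * b) -> P a \/ P b].

Definition maximal_ideal I : Prop :=
  [/\ is_ideal I, ~ I 1 & forall J, is_ideal J -> ~ J 1 -> I `<=` J -> J = I].

Definition noetherian : Prop :=
  forall I, is_ideal I -> exists (n : nat) (x : 'I_n -> R), I = ideal_gen x.

Definition prime_chain (d : nat) (Q : nat -> set R) : Prop :=
  (forall i, (i <= d)%N -> prime_ideal (Q i)) /\
  (forall i, (i < d)%N -> Q i `<` Q i.+1).

Definition krull_dim (d : nat) : Prop :=
  (exists Q, prime_chain d Q) /\ (forall e Q, prime_chain e Q -> (e <= d)%N).

Definition regular_local : Prop :=
  noetherian /\
  exists (m : set R) (d : nat),
    [/\ maximal_ideal m, forall m', maximal_ideal m' -> m' = m, krull_dim d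
      & exists x : 'I_d -> R, m = ideal_gen x].

(* phi exhibits L as the localization of R at the multiplicative set S; this
   determines (L, phi) up to unique isomorphism. *)
Definition is_localization (S : set R) (L : comPzRingType)
    (phi : {rmorphism R -> L}) : Prop :=
  [/\ forall s, S s -> exists t, phi s * t = 1,
      forall y, exists a s, S s /\ y * phi s = phi a
    & forall a, phi a = 0 -> exists2 s, S s & s * a = 0].

Definition powers_of (r : R) : set R := range (fun n : nat => r ^+ n).

(* For q = p ^ s in characteristic p, this is the subring R^q. *)
Definition qth_powers (q : nat) : set R := range (fun x : R => x ^+ q).

Definition generates_over (S : set R) (n : nat) (e : 'I_n -> R) : Prop :=
  forall r, exists2 b : 'I_n -> R,
    forall i, S (b i) & r = \sum_(i < n) b i * e i.

Definition basis_over (S : set R) (n : nat) (e : 'I_n -> R) : Prop :=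
  generates_over S e /\
  forall b : 'I_n -> R, (forall i, S (b i)) ->
    \sum_(i < n) b i * e i = 0 -> forall i, b i = 0.

Definition free_over (S : set R) : Prop :=
  exists (n : nat) (e : 'I_n -> R), basis_over S e.

Definition F_finite (p : nat) : Prop :=
  exists (n : nat) (e : 'I_n -> R), generates_over (qth_powers p) e.

(* I_s(f) when R is free over R^(p^s): the ideal generated by the
   p^s-th roots c_i of the coordinates of f in a basis.  For R reduced the
   roots are unique, and the ideal does not depend on the basis. *)
Definition I_free (p s : nat) (f : R) : set R :=
  [set a | exists (n : nat) (e c : 'I_n -> R),
     [/\ basis_over (qth_powers (p ^ s)) e,
         f = \sum_(i < n) c i ^+ (p ^ s) * e i
       & ideal_gen c a]].

End Ideals.

Definition regular_ring (R : comPzRingType) : Prop :=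
  noetherian R /\
  forall P : set R, prime_ideal P ->
    exists (L : comPzRingType) (phi : {rmorphism R -> L}),
      is_localization (~` P) phi /\ regular_local L.

Definition fg_algebra (A R : comPzRingType) (phi : {rmorphism A -> R}) : Prop :=
  exists (n : nat) (x : 'I_n -> R), forall r : R,
    exists (k : nat) (c : 'I_k -> A) (m : 'I_k -> 'I_n -> nat),
      r = \sum_(j < k) phi (c j) * \prod_(i < n) x i ^+ m j i.

(* The basic opens Spec R_(r i) cover Spec R. *)
Definition spec_cover (R : comPzRingType) (k : nat) (r : 'I_k -> R) : Prop :=
  forall P : set R, prime_ideal P -> exists i, ~ P (r i).

(* The ideal I_s(f) of R glued from the ideals I_s(f) of the members R_(r i) of
   a finite cover with each R_(r i) free over R_(r i)^p: an element belongs
   to it when its image in each R_(r i) belongs to I_s(f).  For R regular and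
   F-finite such covers exist and they all define the same ideal, so it does
   not matter that the cover is quantified inside the comprehension. *)
Definition I_ (R : comPzRingType) (p s : nat) (f : R) : set R :=
  [set a | exists (k : nat) (r : 'I_k -> R),
     spec_cover r /\
     forall i, exists (L : comPzRingType) (phi : {rmorphism R -> L}),
       [/\ is_localization (powers_of (r i)) phi,
           free_over (@qth_powers L p)
         & I_free p s (phi f) (phi a)]].

(* Main.v *)
Require Import Defs.
From mathcomp Require Import all_boot all_algebra.
From mathcomp Require Import boolp classical_sets.
From mathcomp Require Import ring.

(** Write b^[q] for the ideal generated by the q-th powers of the elements of b,
    and q = p^s.  The proof rests on one description of the ideals: I_s(f) is the
    smallest ideal b with f in b^[q].  Over a ring L that is free over L^q this
    is a matter of coordinates: f lies in b^[q] exactly when all the roots c_i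
    of its coordinates lie in b ([frob_coordinates], [I_free_min],
    [I_free_root]).  Globally one has to see that the ideals given by two members
    R_r, R_r' of a cover agree where both are defined, and the minimality in R_r
    gives this without forming R_(r r') ([I_min], [I_root]).

    The roots c_i are unique only because R is reduced.  This follows from
    regularity: a regular local ring is a domain.  Take generators x_1, ..., x_d
    of the maximal ideal and a chain of primes Q_0 < ... < Q_d.  The principal
    ideal theorem lets the chain be rerouted so that its second term contains
    x_1; by induction that term is (x_1), so Q_0 = x_1 Q_0 and Q_0 = 0 by
    Nakayama ([principal_ideal_theorem], [chain_through],
    [regular_chain_bottom]).

    From the description the chain I_s = I_s(f^(p^s - 1)) descends, because
    f^(p^(s+1) - 1) is a multiple of the p-th power of f^(p^s - 1)
    ([I_chain_descends]).  Moreover I_(s+1) = C(I_s), where C(a) is the ideal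
    generated by the I_1(f^(p-1) y) with y in a ([I_succ]).  This C(a) is
    generated by the psi(f^(p-1) a), psi running over the p^(-1)-linear maps
    R -> R; C is monotone and x C(a) is contained in C(x^p a).

    For such an operator on a noetherian ring an argument of Gabber shows that
    the chain I, C(I), C(C(I)), ... stops once it descends
    ([cartier_chain_stops]).  The annihilators of the successive quotients
    increase, so they are eventually a constant ideal A, and every x in A
    satisfies x^2 I_N <= I_n for all n >= N.  If A were proper, localize at a
    minimal prime P of A.  There the quotient of I_N by the sum of the x^2 I_N
    has finite length, so the chain stops, and then some element outside P lies
    in A.  Localization at P is expressed throughout by P-saturated ideals of R,
    and finite length by a descending chain condition on these
    ([saturated_descending_chain]).  The same condition gives the principal
    ideal theorem.

    By its definition I_s(f) is the empty set for every s when Spec R has no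
    finite cover by localizations R_r free over R_r^p; otherwise one such cover
    serves for all s, since R_r is then free over R_r^q too ([free_over_pth]). *)

Set Implicit Arguments.
Unset Strict Implicit.
Unset Printing Implicit Defensive.

Import GRing.Theory.

Local Open Scope classical_set_scope.
Local Open Scope ring_scope.

(** * Ideals *)

Section IdealBasics.
Variable R : comPzRingType.
Implicit Types I J K P : set R.

Lemma ideal_zero I : is_ideal I -> I 0. Proof. by case. Qed.

Lemma ideal_add I a b : is_ideal I -> I a -> I b -> I (a + b).
Proof. by case=> _ h _; apply: h. Qed.

Lemma ideal_mull I a b : is_ideal I -> I b -> I (a * b).
Proof. by case=> _ _ h; apply: h. Qed.

Lemma ideal_mulr I a b : is_ideal I -> I a -> I (a * b).
Proof. by rewrite mulrC; apply: ideal_mull. Qed.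

Lemma ideal_sub I a b : is_ideal I -> I a -> I b -> I (a - b).
Proof. by move=> hI ha hb; rewrite -mulN1r; apply: ideal_add => //; apply: ideal_mull. Qed.

Lemma ideal_sub_cancel I a b : is_ideal I -> I (a - b) -> I b -> I a.
Proof. by move=> hI hab hb; rewrite -[a](subrK b); apply: ideal_add. Qed.

Lemma ideal_sum I (n : nat) (F : 'I_n -> R) :
  is_ideal I -> (forall i, I (F i)) -> I (\sum_(i < n) F i).
Proof.
move=> hI hF; apply: (big_ind I) => //; first exact: ideal_zero.
by move=> *; apply: ideal_add.
Qed.

Lemma ideal_exprS I a n m : is_ideal I -> (n <= m)%N -> I (a ^+ n) -> I (a ^+ m).
Proof. by move=> hI le_nm ?; rewrite -(subnK le_nm) exprD; apply: ideal_mull. Qed.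

Lemma ideal_mulexp I a z n m :
  is_ideal I -> (n <= m)%N -> I (a ^+ n * z) -> I (a ^+ m * z).
Proof.
by move=> hI le_nm ?; rewrite -(subnK le_nm) exprD -mulrA; apply: ideal_mull.
Qed.

Lemma prime_is_ideal P : prime_ideal P -> is_ideal P. Proof. by case. Qed.

Lemma prime_compl_mul P s t : prime_ideal P -> ~ P s -> ~ P t -> ~ P (s * t).
Proof. by case=> _ _ hP hs ht /hP[]. Qed.

Lemma prime_exp P a n : prime_ideal P -> P (a ^+ n) -> P a.
Proof.
case=> _ h1 hP; elim: n => [|n IHn]; first by rewrite expr0 => /h1.
by rewrite exprS => /hP[].
Qed.

Lemma ideal_genP (n : nat) (x : 'I_n -> R) I :
  is_ideal I -> ideal_gen x `<=` I <-> forall i, I (x i).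
Proof.
move=> hI; split=> [h i|h _ [a ->]]; last by apply: ideal_sum => // i; apply: ideal_mull.
apply: h; exists (fun j => (i == j)%:R).
by rewrite (bigD1 i) //= eqxx mul1r big1 ?addr0 // => j /negPf ji; rewrite eq_sym ji mul0r.
Qed.

Lemma ideal_gen_is_ideal (n : nat) (x : 'I_n -> R) : is_ideal (ideal_gen x).
Proof.
split=> [|_ _ [a ->] [b ->]|r _ [a ->]].
- by exists (fun=> 0); rewrite big1 // => i _; rewrite mul0r.
- by exists (fun i => a i + b i); rewrite -big_split; apply: eq_bigr => i _; rewrite mulrDl.
- by exists (fun i => r * a i); rewrite mulr_sumr; apply: eq_bigr => i _; rewrite mulrA.
Qed.

Lemma ideal_gen_mem (n : nat) (x : 'I_n -> R) i : ideal_gen x (x i).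
Proof. by have [h _] := ideal_genP x (ideal_gen_is_ideal x); apply: h. Qed.

(** The impredicative form makes an inclusion out of a generated ideal a matter
    of naming the ideal that receives it. *)
Definition ideal_span (X : set R) : set R :=
  [set a | forall K, is_ideal K -> X `<=` K -> K a].

Lemma ideal_span_ideal X : is_ideal (ideal_span X).
Proof.
split=> [K hK _|a b ha hb K hK XK|a b hb K hK XK]; first exact: ideal_zero.
  by apply: ideal_add => //; [apply: ha|apply: hb].
by apply: ideal_mull => //; apply: hb.
Qed.

Lemma sub_ideal_span X : X `<=` ideal_span X.
Proof. by move=> a Xa K _; apply. Qed.

Lemma ideal_span_sub X K : is_ideal K -> X `<=` K -> ideal_span X `<=` K.
Proof. by move=> hK XK a; apply. Qed.

Lemma ideal_span_mono X Y : X `<=` Y -> ideal_span X `<=` ideal_span Y.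
Proof.
by move=> XY; apply: ideal_span_sub; [apply: ideal_span_ideal|move=> a /XY; apply: sub_ideal_span].
Qed.

Definition colon I J : set R := [set a | forall z, J z -> I (a * z)].

Lemma colon_ideal I J : is_ideal I -> is_ideal (colon I J).
Proof.
move=> hI; split=> [z _|a b ha hb z hz|a b hb z hz]; first by rewrite mul0r; apply: ideal_zero.
  by rewrite mulrDl; apply: ideal_add => //; [apply: ha|apply: hb].
by rewrite -mulrA; apply: ideal_mull => //; apply: hb.
Qed.

Definition radical I : set R := [set a | exists n, I (a ^+ n)].

Lemma radical_ideal I : is_ideal I -> is_ideal (radical I).
Proof.
move=> hI; split=> [|a b [n ha] [m hb]|a b [n hb]].
- by exists 1%N; rewrite expr1; apply: ideal_zero.
- exists (n + m)%N; rewrite exprDn; apply: ideal_sum => // i.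
  rewrite -mulr_natl; apply: ideal_mull => //.
  have [le_mi|lt_im] := leqP m i; first by apply: ideal_mull => //; apply: (ideal_exprS hI le_mi).
  by apply: ideal_mulr => //; apply: (ideal_exprS hI _ ha); rewrite -addnBA ?leq_addr // ltnW.
- by exists n; rewrite exprMn; apply: ideal_mull.
Qed.

Definition add_gen I (x : R) : set R := [set a | exists2 z, I z & exists r, a = z + r * x].

Lemma add_gen_ideal I x : is_ideal I -> is_ideal (add_gen I x).
Proof.
move=> hI; split=> [|_ _ [z hz [r ->]] [z' hz' [r' ->]]|a _ [z hz [r ->]]].
- by exists 0; [apply: ideal_zero|exists 0; rewrite mul0r addr0].
- by exists (z + z'); [apply: ideal_add|exists (r + r'); ring].
- by exists (a * z); [apply: ideal_mull|exists (a * r); ring].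
Qed.

Lemma sub_add_gen I x : I `<=` add_gen I x.
Proof. by move=> a Ia; exists a => //; exists 0; rewrite mul0r addr0. Qed.

Lemma add_gen_mem I x : is_ideal I -> add_gen I x x.
Proof. by move=> hI; exists 0; [apply: ideal_zero|exists 1; rewrite mul1r add0r]. Qed.

Lemma add_gen_sub I x K : is_ideal K -> I `<=` K -> K x -> add_gen I x `<=` K.
Proof.
by move=> hK IK Kx _ [z hz [r ->]]; apply: ideal_add => //; [apply: IK|apply: ideal_mull].
Qed.

End IdealBasics.

(** * Noetherian rings and saturation at a prime *)

Section Noetherian.
Variable R : comPzRingType.
Hypothesis noethR : noetherian R.
Implicit Types I J K P : set R.

(** If no member of [F] were maximal, choice would give a strictly increasing
    sequence; finitely many generators of its union already lie in one term. *)
Lemma noetherian_max (F : set (set R)) I0 : F I0 -> (forall I, F I -> is_ideal I) ->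
  exists2 I, F I & forall J, F J -> I `<=` J -> J `<=` I.
Proof.
move=> FI0 Fid; apply: contrapT => nomax.
have step (X : {I | F I}) : exists Y : {I | F I}, sval X `<=` sval Y /\ ~ (sval Y `<=` sval X).
  case: X => I FI; apply: contrapT => noY; apply: nomax; exists I => // J FJ IJ.
  by apply: contrapT => nJI; apply: noY; exists (exist _ J FJ).
have [g gP] := choice step.
pose u n := sval (iter n g (exist _ I0 FI0)).
have uid n : is_ideal (u n) by apply: Fid; rewrite /u; case: (iter _ _ _).
have uS n : u n `<=` u n.+1 by case: (gP (iter n g (exist _ I0 FI0))).
have uSN n : ~ (u n.+1 `<=` u n) by case: (gP (iter n g (exist _ I0 FI0))).
have um n m : (n <= m)%N -> u n `<=` u m.
  move/subnK => <-; elim: (m - n)%N => [|k IHk]; first by [].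
  by move=> a /IHk; rewrite addSn; apply: uS.
pose U : set R := [set a | exists n, u n a].
have Uid : is_ideal U.
  split=> [|a b [n ha] [m hb]|a b [n hb]]; first by exists 0%N; apply: ideal_zero.
  - exists (maxn n m); apply: ideal_add => //; first by apply: um ha; rewrite leq_maxl.
    by apply: um hb; rewrite leq_maxr.
  - by exists n; apply: ideal_mull.
have [k [x Ux]] := noethR Uid.
have /choice[N NP] (i : 'I_k) : exists n, u n (x i).
  by have := ideal_gen_mem x i; rewrite -Ux.
apply: (uSN (\max_(i < k) N i)) => a ua.
have : U a by exists (\max_(i < k) N i).+1.
rewrite Ux; have [_ h] := ideal_genP x (uid (\max_(i < k) N i)).
by apply: h => i; apply: um (NP i); apply: leq_bigmax.
Qed.

Lemma ascending_chain_stops (u : nat -> set R) : (forall n, is_ideal (u n)) ->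
  (forall n, u n `<=` u n.+1) -> exists N, forall n, (N <= n)%N -> u n = u N.
Proof.
move=> uid uS; have um n m : (n <= m)%N -> u n `<=` u m.
  move/subnK => <-; elim: (m - n)%N => [|k IHk]; first by [].
  by move=> a /IHk; rewrite addSn; apply: uS.
have [|I [n _]|_ [N _ <-] maxN] := @noetherian_max (range u) (u 0%N).
- by exists 0%N.
- by move<-.
exists N => n le_Nn; apply/seteqP; split; last exact: um.
by apply: maxN; [exists n|apply: um].
Qed.

(** [P] is the colon ideal of the radical of [I] by an element [t]; it is prime
    when it is maximal among these.  The clause on powers says that [I] and [P]
    have the same radical once [t] is inverted, so that [P] is minimal over [I]. *)
Lemma minimal_prime I : is_ideal I -> ~ I 1 ->
  exists P t, [/\ prime_ideal P, I `<=` P, ~ P t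
                & forall x, P x -> exists k, I ((x * t) ^+ k)].
Proof.
move=> hI I1; set r := radical I; have hr : is_ideal r by apply: radical_ideal.
have r2 a : r (a * a) -> r a by case=> n h; exists (n + n)%N; rewrite exprD -exprMn.
pose F : set (set R) := [set K | exists2 t, ~ r t & K = [set x | r (x * t)]].
have Fid K : F K -> is_ideal K.
  case=> t _ ->; split=> [|a b|a b]; rewrite /= ?mul0r ?mulrDl -?mulrA.
  - exact: ideal_zero.
  - exact: ideal_add.
  - exact: ideal_mull.
have [|_ [t rt ->] maxP] := @noetherian_max F [set x | r (x * 1)] _ Fid.
  by exists 1 => // -[n]; rewrite expr1n.
exists [set x | r (x * t)], t; split=> //.
- split; [by apply: Fid; exists t|by rewrite /= mul1r|move=> a b /= rabt].
  apply: contrapT => /not_orP[nra nrb]; apply: nra.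
  have : [set x | r (x * (b * t))] `<=` [set x | r (x * t)].
    apply: maxP; first by exists (b * t).
    by move=> x /= rxt; rewrite mulrCA; apply: ideal_mull.
  by apply; rewrite /= mulrA.
- by move=> x Ix; exists 1%N; rewrite expr1; apply: ideal_mulr.
- by move/r2.
Qed.

(** [P]-saturated ideals of R correspond to the ideals of the localization at
    [P]; [sat P K] is the preimage in R of the localization of [K]. *)
Definition saturated P K := forall t z, ~ P t -> K (t * z) -> K z.
Definition sat P K : set R := [set z | exists2 t, ~ P t & K (t * z)].

Lemma sat_ideal P K : prime_ideal P -> is_ideal K -> is_ideal (sat P K).
Proof.
move=> hP hK; split=> [|a b [s hs ha] [t ht hb]|a b [t ht hb]].
- by case: hP => _ h1 _; exists 1; rewrite ?mulr0 //; apply: ideal_zero.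
- exists (s * t); first exact: prime_compl_mul.
  have -> : s * t * (a + b) = t * (s * a) + s * (t * b) by ring.
  by apply: ideal_add => //; apply: ideal_mull.
- by exists t => //; rewrite mulrCA; apply: ideal_mull.
Qed.

Lemma sub_sat P K : prime_ideal P -> K `<=` sat P K.
Proof. by case=> _ h1 _ a Ka; exists 1 => //; rewrite mul1r. Qed.

Lemma sat_saturated P K : prime_ideal P -> saturated P (sat P K).
Proof. by move=> hP t z ht [s hs hz]; exists (s * t); [apply: prime_compl_mul|rewrite -mulrA]. Qed.

Lemma sat_mono P J K : J `<=` K -> sat P J `<=` sat P K.
Proof. by move=> JK z [t ht /JK hz]; exists t. Qed.

(** Nakayama over the localization at [P].  The premise says that [I] lies in the
    saturation of [N + P I], phrased by quantifying over the saturated ideals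
    that contain [N] and [P I].  If the conclusion fails, take a saturated [K]
    above [N] that is maximal among those not containing [I].  Adding any a y
    outside [K] (a in P, y in I) would capture y itself, and then
    t y = k + r a y makes (t - r a) y, hence y, a member of [K].  So [K] contains
    [P I], hence [I]. *)
Lemma nakayama P I N : prime_ideal P -> is_ideal I -> is_ideal N ->
  (forall K, is_ideal K -> saturated P K -> N `<=` K ->
     (forall a y, P a -> I y -> K (a * y)) -> I `<=` K) ->
  I `<=` sat P N.
Proof.
move=> hP hI hN hK; apply: contrapT => nIN.
pose F : set (set R) := [set K | [/\ is_ideal K, saturated P K, N `<=` K & ~ (I `<=` K)]].
have [||K [Kid Ksat NK nIK] maxK] := @noetherian_max F (sat P N).
- split=> //; [exact: sat_ideal|exact: sat_saturated|exact: sub_sat].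
- by move=> K [].
apply: nIK; apply: hK => // a y Pa Iy; apply: contrapT => nKay.
have Pid := prime_is_ideal hP.
have IK' : I `<=` sat P (add_gen K (a * y)).
  apply: contrapT => nI; apply: nKay.
  apply: (maxK (sat P (add_gen K (a * y)))); last 1 first.
  - by apply: sub_sat => //; apply: add_gen_mem.
  - split=> //; [by apply/sat_ideal/add_gen_ideal|exact: sat_saturated|].
    by move=> z /NK Kz; apply: sub_sat => //; apply: sub_add_gen.
  - by move=> z Kz; apply: sub_sat => //; apply: sub_add_gen.
have [t nPt [k Kk [r E]]] := IK' _ Iy.
apply: nKay; apply: ideal_mull => //; apply: (Ksat (t - r * a)).
  by move=> h; apply: nPt; apply: (ideal_sub_cancel Pid h); apply: ideal_mull.
by have -> : (t - r * a) * y = k by rewrite mulrBl E; ring.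
Qed.

(** A nonzero module over the localization at [P] on which every element of [P]
    is nilpotent has a nonzero element killed by [P]: multiply by powers of the
    generators of [P], one generator after the other. *)
Lemma socle P M c : prime_ideal P -> is_ideal M -> is_ideal c ->
  (forall x, P x -> exists m, forall z, M z -> c (x ^+ m * z)) -> ~ (M `<=` c) ->
  exists y, [/\ M y, ~ c y & forall a, P a -> c (a * y)].
Proof.
move=> hP hM hc hnil hMc; have [k [x Px]] := noethR (prime_is_ideal hP).
have {}hnil (i : 'I_k) : exists m, forall z, M z -> c (x i ^+ m * z).
  by apply: hnil; rewrite Px; apply: ideal_gen_mem.
suff /(_ k (leqnn k)) [y [My ncy ycx]] : forall j, (j <= k)%N -> exists y,
    [/\ M y, ~ c y & forall i : 'I_k, (i < j)%N -> c (x i * y)].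
  exists y; split=> // a; rewrite Px => -[b ->].
  rewrite mulr_suml; apply: ideal_sum => // i.
  by rewrite -mulrA; apply: ideal_mull => //; apply: ycx.
elim=> [_|j IHj lt_jk].
  have [y My ncy] : exists2 y, M y & ~ c y.
    apply: contrapT => h; apply: hMc => y My; apply: contrapT => ncy.
    by apply: h; exists y.
  by exists y.
have [y [My ncy ycx]] := IHj (ltnW lt_jk).
pose i0 := Ordinal lt_jk; have [m /(_ _ My)] := hnil i0.
elim: m => [|m IHm]; first by rewrite mul1r.
have [/IHm //|nc] := pselect (c (x i0 ^+ m * y)).
move=> cx; exists (x i0 ^+ m * y); split=> // [|i]; first exact: ideal_mull.
rewrite ltnS leq_eqVlt => /orP[/eqP ij|/ycx ?]; last by rewrite mulrCA; apply: ideal_mull.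
by have -> : i = i0 by [apply: val_inj; rewrite /= ij]; rewrite mulrA -exprS.
Qed.

(** The localization of [M / c] at [P] has finite length.  The proof is an
    induction on [c] from above: a socle element [y] generates a simple submodule,
    the chain stops modulo [y], and within the simple submodule it can only drop
    once. *)
Lemma saturated_descending_chain P M c (u : nat -> set R) :
  prime_ideal P -> is_ideal M -> saturated P M -> is_ideal c -> saturated P c ->
  (forall x, P x -> exists m, forall z, M z -> c (x ^+ m * z)) ->
  (forall n, [/\ is_ideal (u n), saturated P (u n), c `<=` u n & u n `<=` M]) ->
  (forall n, u n.+1 `<=` u n) ->
  exists N, forall n, (N <= n)%N -> u n `<=` u n.+1.
Proof.
move=> hP hM sM hc sc hnil huc udec; apply: contrapT => ustop.
pose chain c u := (forall n, [/\ is_ideal (u n), saturated P (u n), c `<=` u n & u n `<=` M])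
  /\ (forall n, u n.+1 `<=` u n).
pose stops (u : nat -> set R) := exists N, forall n, (N <= n)%N -> u n `<=` u n.+1.
pose F : set (set R) := [set d | [/\ is_ideal d, saturated P d, c `<=` d
  & exists2 u, chain d u & ~ stops u]].
have Fc : F c by split=> //; exists u.
have [_ []//|d [hd sd cd [v [vd vdec] vstop]] maxd] := noetherian_max Fc.
have [y [My ndy yd]] : exists y, [/\ M y, ~ d y & forall a, P a -> d (a * y)].
  apply: (@socle P) => // [x /hnil [m xm]|Md].
    by exists m => z /xm; apply: cd.
  apply: vstop; exists 0%N => n _ z vz.
  by have [_ _ _ /(_ _ vz) /Md dz] := vd n; have [_ _ + _] := vd n.+1; apply.
(* The chain modulo y lies above the larger base sat (d + R y). *)
pose w n := sat P (add_gen (v n) y).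
have hv n : is_ideal (v n) by case: (vd n).
have [N wN] : stops w.
  apply: contrapT => wstop; apply: ndy.
  have hdy : is_ideal (add_gen d y) by apply: add_gen_ideal.
  apply: (maxd (sat P (add_gen d y))); last 1 first.
  - by apply: sub_sat => //; apply: add_gen_mem.
  - split; [exact: sat_ideal|exact: sat_saturated| |exists w => //].
      by move=> z /cd dz; apply: sub_sat => //; apply: sub_add_gen.
    split=> n; last first.
      apply: sat_mono; apply: add_gen_sub; [exact: add_gen_ideal| |exact: add_gen_mem].
      by move=> z /vdec; apply: sub_add_gen.
    split; [by apply/sat_ideal/add_gen_ideal|exact: sat_saturated| |].
    + apply: sat_mono; apply: add_gen_sub; [exact: add_gen_ideal| |exact: add_gen_mem].
      by case: (vd n) => _ _ dv _ z /dv; apply: sub_add_gen.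
    + move=> z [t nPt] h; apply: (sM t) => //; move: h; apply: add_gen_sub => //.
      by case: (vd n).
  - by move=> z dz; apply: sub_sat => //; apply: sub_add_gen.
have vm n m : (n <= m)%N -> v m `<=` v n.
  move/subnK => <-; elim: (m - n)%N => [|k IHk]; first by [].
  by rewrite addSn => a /vdec; apply: IHk.
suff [N' hN'] : exists N', forall n r, (N' <= n)%N -> v n (r * y) -> v n.+1 (r * y).
  apply: vstop; exists (maxn N N') => n; rewrite geq_max => /andP[leN leN'] z vz.
  have : w n z by apply: sub_sat => //; apply: sub_add_gen.
  move=> /(wN _ leN) [t nPt [z' vz' [r E]]].
  have [_ svn _ _] := vd n.+1; apply: (svn t) => //; rewrite E; apply: ideal_add => //.
  apply: hN' => //; have -> : r * y = t * z - z' by rewrite E; ring.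
  by apply: ideal_sub => //; [apply: ideal_mull|apply: vdec].
(* If v n misses y, then r y in v n forces r in P, and P y lies in d. *)
have [ally|] := pselect (forall n, v n y).
  by exists 0%N => n r _ _; apply: ideal_mull.
move=> /existsNP[N' nvy]; exists N' => n r leN' vry.
have [Pr|nPr] := pselect (P r); first by case: (vd n.+1) => _ _ + _; apply; apply: yd.
by case: nvy; apply: vm leN' _ _; have [_ sv _ _] := vd n; apply: sv vry.
Qed.
End Noetherian.

(** * The principal ideal theorem and regular local rings *)

Section Krull.
Variable R : comPzRingType.
Hypothesis noethR : noetherian R.
Implicit Types I J K M P Q : set R.

(** The [Q]-saturation of [Q0 + Q S]; iterated from the unit ideal it gives the
    symbolic powers of [Q] modulo [Q0]. *)
Definition symbolic_step Q0 Q (S : set R) : set R :=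
  [set a | forall K, is_ideal K -> saturated Q K -> Q0 `<=` K ->
     (forall a y, Q a -> S y -> K (a * y)) -> K a].

(** Krull: a prime [P] minimal over [Q0 + (x)] has no prime strictly between it
    and [Q0].  Modulo [x] the symbolic powers of [Q1] form a descending chain in
    a ring that has finite length at [P], so some n has S n = S (n+1) + x S n after
    localizing at [P], as [x] is outside [Q1]; Nakayama at [P] removes x S n, and Nakayama at [Q1] then
    pushes S n into [Q0]. *)
Lemma principal_ideal_theorem Q0 Q1 P x :
  prime_ideal Q0 -> prime_ideal Q1 -> prime_ideal P ->
  Q0 `<=` Q1 -> Q1 `<=` P -> P x -> ~ Q1 x ->
  (forall Q, prime_ideal Q -> Q0 `<=` Q -> Q x -> Q `<=` P -> P `<=` Q) ->
  Q1 `<=` Q0.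
Proof.
move=> hQ0 hQ1 hP Q01 Q1P Px nQ1x minP.
have iQ0 := prime_is_ideal hQ0; have iP := prime_is_ideal hP.
pose J := sat P (add_gen Q0 x).
have iJ : is_ideal J by apply/sat_ideal/add_gen_ideal.
have sJ : saturated P J by apply: sat_saturated.
have QJ : add_gen Q0 x `<=` J by apply: sub_sat.
have Pnil y : P y -> exists m, J (y ^+ m).
  have J1 : ~ J 1.
    case=> t nPt; rewrite mulr1; suff: add_gen Q0 x `<=` P by move=> h /h.
    by apply: add_gen_sub => // z /Q01 /Q1P.
  have [Q [t [hQ JQ nQt Qnil]]] := minimal_prime noethR iJ J1.
  have QP : Q `<=` P.
    move=> u Qu; apply: contrapT => nPu; apply: nQt.
    have [k] := Qnil _ Qu; rewrite exprMn => utk.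
    apply: (@prime_exp _ Q t k) => //; apply: JQ; apply: sJ utk.
    by move/(prime_exp hP).
  have PQ : P `<=` Q.
    apply: minP => //; first by move=> z Qz; apply/JQ/QJ/sub_add_gen.
    by apply/JQ/QJ; apply: add_gen_mem.
  move=> /PQ Qy; have [k] := Qnil _ Qy; rewrite exprMn mulrC => ytk; exists k.
  by apply: sJ ytk => /(prime_exp hP) /PQ.
pose S n : set R := iter n (symbolic_step Q0 Q1) setT.
have iS n : is_ideal (S n).
  case: n => [|n] //; split=> [K iK _ _ _|a b ha hb K iK sK QK SK|a b hb K iK sK QK SK].
  - exact: ideal_zero.
  - by apply: ideal_add => //; [apply: ha|apply: hb].
  - by apply: ideal_mull => //; apply: hb.
have sS n : saturated Q1 (S n).
  by case: n => [|n] // t z nt tz K iK sK QK SK; apply: (sK t) => //; apply: tz.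
have QS n : Q0 `<=` S n by case: n => [|n] // z Qz K _ _ QK _; apply: QK.
have Sdec n : S n.+1 `<=` S n.
  by move=> z; apply=> // a y _; apply: ideal_mull.
have QSS n a y : Q1 a -> S n y -> S n.+1 (a * y).
  by move=> Qa Sy K _ _ _; apply.
pose u n := sat P (add_gen (S n) x).
have [n un] : exists N, forall n, (N <= n)%N -> u n `<=` u n.+1.
  apply: (@saturated_descending_chain _ noethR P setT J u) => //.
  - by move=> y /Pnil [m ym]; exists m => z _; apply: ideal_mulr.
  - move=> n; split=> //; [by apply/sat_ideal/add_gen_ideal|exact: sat_saturated|].
    apply: sat_mono; apply: add_gen_sub; [exact: add_gen_ideal| |exact: add_gen_mem].
    by move=> z Qz; apply/sub_add_gen/QS.
  - move=> n; apply: sat_mono; apply: add_gen_sub; [exact: add_gen_ideal| |exact: add_gen_mem].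
    by move=> z Sz; apply/sub_add_gen/Sdec.
have SS : S n `<=` S n.+1.
  have h : S n `<=` sat P (S n.+1).
    apply: nakayama => // K iK sK SK PSK z Sz.
    have : u n z by apply: sub_sat => //; apply: sub_add_gen.
    move=> /(un n (leqnn n)) [t nPt [w Sw [r E]]]; apply: (sK t) => //; rewrite E.
    apply: ideal_add => //; first exact: SK.
    rewrite mulrC; apply: PSK => //; apply: (sS n x) => //.
    have -> : x * r = t * z - w by rewrite E; ring.
    by apply: ideal_sub => //; [apply: ideal_mull|apply: Sdec].
  by move=> z /h [t nPt]; apply: sS => /Q1P.
have SQ : S n `<=` Q0.
  have h : S n `<=` sat Q1 Q0.
    by apply: nakayama => // K iK sK QK QSK z /SS; apply.
  by move=> z /h [t nQ1t]; case: hQ0 => _ _ pQ0 /pQ0 [/Q01 /nQ1t|].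
move=> a Q1a; apply: (@prime_exp _ Q0 a n) => //; apply: SQ.
by elim: (n) => [|k IHk] //; rewrite exprS; apply: QSS.
Qed.

(** By the principal ideal theorem the last prime before the top can be replaced
    by one that contains [x], as long as a prime strictly below it remains;
    descending along the chain this reaches the second term. *)
Lemma chain_through d (Q : nat -> set R) x : prime_chain d.+1 Q -> Q d.+1 x ->
  exists Q' : nat -> set R, [/\ prime_chain d Q', Q 0%N `<` Q' 0%N, Q' 0%N x & Q' d = Q d.+1].
Proof.
elim: d Q => [|d IHd] Q [Qpr Qlt] Qx.
  exists (fun=> Q 1%N); split=> //; [split=> // i _; exact: Qpr|exact: Qlt].
(* T replaces the last but one prime of the chain. *)
have [T [hT dT Td2 Tx]] : exists T : set R, [/\ prime_ideal T, Q d `<` T, T `<` Q d.+2 & T x].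
  have [Qd1|nQd1] := pselect (Q d.+1 x).
    by exists (Q d.+1); split=> //; [apply: Qpr|apply: Qlt|apply: Qlt].
  apply: contrapT => noT.
  have [Q01 nQ10] := Qlt d (leqnSn _); have [Q1P nP1] := Qlt d.+1 (leqnn _).
  apply: nQ10; apply: (@principal_ideal_theorem (Q d) (Q d.+1) (Q d.+2) x) => //.
  - by apply: Qpr; rewrite -addn2 leq_addr.
  - exact: Qpr.
  - exact: Qpr.
  move=> T hT QT Tx TP; apply: contrapT => nPT; apply: noT; exists T; split=> //.
  by split=> // TQ; apply/nQd1/Q01/TQ.
pose Q1 i := if (i <= d)%N then Q i else T.
have [||Q' [[Q'pr Q'lt] Q'0 Q'x Q'd]] := IHd Q1.
- split=> i lei.
    by rewrite /Q1; case: ifP => // led; apply: Qpr; rewrite (leq_trans led) // ltnW.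
  rewrite /Q1 -ltnS lei; case: ifP => [lti|]; first by apply: Qlt; rewrite ltnW.
  by move/negbT; rewrite -ltnNge => ledi; have -> : i = d by apply/eqP; rewrite eqn_leq -ltnS lei.
- by rewrite /Q1 ltnn.
exists (fun i => if (i <= d)%N then Q' i else Q d.+2); split; rewrite ?ltnn //.
split=> i lei; first by case: ifP => // led; [apply: Q'pr|apply: Qpr].
rewrite -ltnS lei; case: ifP => [lti|]; first exact: Q'lt.
move/negbT; rewrite -ltnNge => ledi; have -> : i = d by apply/eqP; rewrite eqn_leq -ltnS lei.
by rewrite Q'd /Q1 ltnn.
Qed.

(** The ring R/J is local with maximal ideal generated by d elements and has a
    chain of d+1 primes, hence it is a domain.  Working relative to [J] keeps
    the induction inside one ring: passing to R/(x_0) is enlarging [J] by x_0. *)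
Lemma regular_chain_bottom M d (x : 'I_d -> R) J (Q : nat -> set R) :
  prime_ideal M -> (forall t, ~ M t -> exists u, u * t = 1) ->
  is_ideal J -> prime_chain d Q -> J `<=` Q 0%N -> Q d = M ->
  (forall i, M (x i)) ->
  (forall K, is_ideal K -> J `<=` K -> (forall i, K (x i)) -> M `<=` K) ->
  Q 0%N `<=` J.
Proof.
move=> hM unitM; elim: d J x Q => [|d IHd] J x Q iJ hQ JQ QM Mx MJ.
  by rewrite QM; apply: MJ => // -[].
set x0 := x ord0.
have [|Q' [hQ' [Q0Q' nQ'Q0] Q'x Q'd]] := @chain_through d Q x0 hQ.
  by rewrite QM; apply: Mx.
have pQ0 : prime_ideal (Q 0%N) by case: hQ => + _; apply.
have iQ0 := prime_is_ideal pQ0.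
have Q'J : Q' 0%N `<=` add_gen J x0.
  apply: (IHd _ (fun i => x (lift ord0 i))) => //; last 1 first.
  - move=> K iK JK Kx; apply: MJ => //; first by move=> z Jz; apply/JK/sub_add_gen.
    move=> i; case: (unliftP ord0 i) => [j ->|->]; first exact: Kx.
    by apply: JK; apply: add_gen_mem.
  - exact: add_gen_ideal.
  - apply: add_gen_sub => //; last by move=> z /JQ /Q0Q'.
    by case: hQ' => + _ => /(_ 0%N isT) [].
  - by rewrite Q'd.
have nQ0x : ~ Q 0%N x0.
  by move=> Qx; apply: nQ'Q0 => z /Q'J; apply: add_gen_sub.
have h : Q 0%N `<=` sat M J.
  apply: nakayama => // K iK _ JK MK z Qz.
  have [j Jj [r E]] := Q'J _ (Q0Q' _ Qz).
  have : Q 0%N (r * x0).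
    have -> : r * x0 = z - j by rewrite E; ring.
    by apply: ideal_sub => //; apply: JQ.
  case: pQ0 => _ _ pQ0 /pQ0 [Qr|//].
  by rewrite E; apply: ideal_add => //; [apply: JK|rewrite mulrC; apply: MK => //; apply: Mx].
move=> z /h [t /unitM [v vt] Jtz]; rewrite -[z]mul1r -vt -mulrA.
exact: ideal_mull.
Qed.

Lemma maximal_above I : is_ideal I -> ~ I 1 -> exists2 M, maximal_ideal M & I `<=` M.
Proof.
move=> iI nI1; pose F : set (set R) := [set J | [/\ is_ideal J, ~ J 1 & I `<=` J]].
have [|_ []//|M [iM nM1 IM] maxM] := @noetherian_max _ noethR F I; first by split.
exists M => //; split=> // J iJ nJ1 MJ; apply/seteqP; split=> //.
by apply: maxM => //; split=> // z /IM /MJ.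
Qed.

Lemma maximal_prime M : maximal_ideal M -> prime_ideal M.
Proof.
case=> iM nM1 maxM; split=> // a b Mab; apply: contrapT => /not_orP[nMa nMb].
have iMa := add_gen_ideal a iM.
have [[m Mm [r E]]|n1] := pselect (add_gen M a 1).
  apply: nMb; rewrite -[b]mul1r E mulrDl -mulrA.
  by apply: ideal_add => //; [apply: ideal_mulr|apply: ideal_mull].
by apply: nMa; rewrite -(maxM _ iMa n1 (@sub_add_gen _ _ _)); apply: add_gen_mem.
Qed.

End Krull.

Lemma regular_local_domain (R : comPzRingType) (a b : R) :
  regular_local R -> a * b = 0 -> a = 0 \/ b = 0.
Proof.
case=> noethR [M [d [maxM uniqM [[Q hQ] _] [x Mx]]]].
have hM := maximal_prime maxM.
have primeM P : prime_ideal P -> P `<=` M.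
  case=> iP nP1 _; have [M' /uniqM -> //] := maximal_above noethR iP nP1.
have unitM t : ~ M t -> exists u, u * t = 1.
  move=> nMt; apply: contrapT => nu; apply: nMt.
  have i0 : is_ideal [set 0 : R].
    by split=> [|? ? -> ->|? ? ->] /=; rewrite ?addr0 ?mulr0.
  have [||M' /uniqM -> tM] := @maximal_above R noethR (add_gen [set 0] t).
  - exact: add_gen_ideal.
  - by case=> _ -> [u]; rewrite add0r => E; apply: nu; exists u.
  - by apply: tM; apply: add_gen_mem.
pose Q' i := if (i < d)%N then Q i else M.
have hQ' : prime_chain d Q'.
  case: hQ => Qpr Qlt; split=> i lei; rewrite /Q'.
    by case: ifP => // lti; apply: Qpr.
  rewrite lei; case: ifP => // _; first exact: Qlt.
  have [QQ nQQ] := Qlt _ lei; have := primeM _ (Qpr _ lei) => QM.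
  by split=> [z /QQ /QM //|MQ]; apply: nQQ => z /QM /MQ.
have Q0 : Q' 0%N `<=` [set 0].
  apply: (@regular_chain_bottom R noethR M d x [set 0] Q') => //.
  - by split=> [|? ? -> ->|? ? ->] /=; rewrite ?addr0 ?mulr0.
  - by move=> _ ->; have [prQ _] := hQ'; apply: ideal_zero (prime_is_ideal (prQ 0%N isT)).
  - by rewrite /Q' ltnn.
  - by move=> i; rewrite Mx; apply: ideal_gen_mem.
  - by move=> K iK _ Kx; rewrite Mx; apply/ideal_genP.
have [pr0 _] := hQ'; have [i0 _ p0] := pr0 0%N isT.
move=> ab0; have : Q' 0%N (a * b) by rewrite ab0; apply: ideal_zero.
by case/p0 => /Q0 ->; [left|right].
Qed.

(** The annihilator of a nonzero nilpotent would be contained in a prime, and the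
    localization there is a domain. *)
Lemma regular_reduced (R : comPzRingType) (a : R) n :
  regular_ring R -> a ^+ n = 0 -> a = 0.
Proof.
case=> noethR regR an0; apply: contrapT => a0.
pose I : set R := [set r | r * a = 0].
have iI : is_ideal I.
  split; rewrite /I /=; first exact: mul0r.
    by move=> r s ra sa; rewrite mulrDl ra sa addr0.
  by move=> r s sa; rewrite -mulrA sa mulr0.
have [|P [_ [hP IP _ _]]] := minimal_prime noethR iI.
  by rewrite /I /= mul1r.
have [L [phi [[_ _ ker] regL]]] := regR P hP.
have : phi a ^+ n = 0 by rewrite -rmorphXn an0 rmorph0.
suff pa0 : phi a <> 0.
  elim: n {an0} => [|n IHn]; last by rewrite exprS => /(regular_local_domain regL) [].
  by rewrite expr0 => h; apply: pa0; rewrite -[phi a]mul1r h mul0r.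
by move=> /ker [s nPs /IP].
Qed.

(** * Chains of images under a p-inverse linear operator *)

Section CartierChain.
Variable R : comPzRingType.
Hypothesis noethR : noetherian R.

(** The conditions on [C] are those of the operator sending an ideal [X] to the
    ideal generated by the psi(X), for a family of additive maps psi with
    psi(x^p y) = x psi(y). *)
Lemma cartier_chain_stops (p : nat) (C : set R -> set R) (u : nat -> set R) :
  (1 < p)%N ->
  (forall X Y, X `<=` Y -> C X `<=` C Y) ->
  (forall X x a, C X a -> C [set x ^+ p * y | y in X] (x * a)) ->
  (forall n, is_ideal (u n)) ->
  (forall n, u n.+1 = C (u n)) -> (forall n, u n.+1 `<=` u n) ->
  exists N, forall n, (N <= n)%N -> u n `<=` u n.+1.
Proof.
move=> p_gt1 Cmono Clin uid uC udec.
pose A n := colon (u n.+1) (u n).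
have Aid n : is_ideal (A n) by apply: colon_ideal.
have AS n : A n `<=` A n.+1.
  move=> x Ax z; rewrite (uC n) (uC n.+1) => /(Clin _ x); apply: Cmono => _ [y uy <-].
  rewrite -(prednK (ltnW p_gt1)) exprSr -mulrA; apply: ideal_mull => //.
  exact: Ax.
have [N AN] := ascending_chain_stops noethR Aid AS.
have [AN1|nAN1] := pselect (A N 1).
  exists N => n leNn z uz; have : A n 1 by rewrite AN.
  by move=> /(_ _ uz); rewrite mul1r.
have [P [t [hP AP nPt Pnil]]] := minimal_prime noethR (Aid N) nAN1.
(* x x (u N) <= x C(u N) <= C(x^p u N), and p >= 2 feeds the previous case. *)
have A2 x n z : A N x -> u N z -> u (N + n)%N (x ^+ 2 * z).
  move=> Ax; elim: n z => [|n IHn] z uz; first by rewrite addn0; apply: ideal_mull.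
  rewrite addnS uC expr2 -mulrA.
  have : C (u N) (x * z) by rewrite -uC; apply: Ax.
  move=> /(Clin _ x); apply: Cmono => _ [y uy <-].
  by rewrite -(subnK p_gt1) exprD -mulrA; apply: ideal_mull => //; apply: IHn.
have satid n : is_ideal (sat P (u n)) by apply: sat_ideal.
pose c : set R := [set z | forall n, sat P (u (N + n)%N) z].
have [|||||||n0 un0] := @saturated_descending_chain _ noethR P (sat P (u N)) c
    (fun n => sat P (u (N + n)%N)) hP.
- by [].
- exact: sat_saturated.
- split=> [n|a b ca cb n|a b cb n]; first exact: ideal_zero.
    by apply: ideal_add.
  by apply: ideal_mull.
- by move=> s z nPs csz n; apply: (sat_saturated hP nPs).
- move=> x /Pnil [k Axt]; exists (k * 2)%N => z [s nPs usz] n.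
  exists (t ^+ (k * 2) * s); first by apply: prime_compl_mul => // /(prime_exp hP).
  have -> : t ^+ (k * 2) * s * (x ^+ (k * 2) * z) = ((x * t) ^+ k) ^+ 2 * (s * z).
    by rewrite -exprM exprMn; ring.
  exact: A2.
- move=> n; split=> //; first exact: sat_saturated.
  apply: sat_mono; elim: n => [|n IHn]; first by rewrite addn0.
  by rewrite addnS => z /udec /IHn.
- by move=> n; rewrite addnS; apply: sat_mono.
(* A common denominator s for finitely many generators turns the inclusion of
   saturations into s u(n) <= u(n+1), so s lies in the annihilator. *)
have [k [x ux]] := noethR (uid (N + n0)%N).
have /choice[s sP] (i : 'I_k) : exists s, ~ P s /\ u (N + n0).+1 (s * x i).
  have : sat P (u (N + n0)%N) (x i).
    by apply: sub_sat => //; rewrite ux; apply: ideal_gen_mem.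
  by move=> /(un0 n0 (leqnn _)); rewrite addnS => -[s]; exists s.
have nPs : ~ P (\prod_(i < k) s i).
  apply: (big_ind (fun a => ~ P a)); first by case: hP.
    by move=> a b; apply: prime_compl_mul.
  by move=> i _; case: (sP i).
exfalso; apply: nPs; apply: AP; rewrite -(AN (N + n0)%N (leq_addr _ _)) => z.
rewrite ux => -[b ->]; rewrite mulr_sumr; apply: ideal_sum => // i.
rewrite mulrCA; apply: ideal_mull => //; rewrite (bigD1 i) //= mulrAC mulrC.
by apply: ideal_mull => //; case: (sP i).
Qed.

End CartierChain.

(** * Frobenius powers of ideals *)

Section FrobeniusPower.
Variables (p : nat) (R : comPzRingType).
Hypotheses (p_prime : prime p) (charR : p%:R = 0 :> R).

Lemma exprD_char (a b : R) s : (a + b) ^+ (p ^ s) = a ^+ (p ^ s) + b ^+ (p ^ s).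
Proof.
have addp (x y : R) : (x + y) ^+ p = x ^+ p + y ^+ p.
  have p_gt0 := prime_gt0 p_prime.
  rewrite exprDn (bigD1 ord0) //= (bigD1 ord_max) //=; last by rewrite -val_eqE /= -lt0n.
  rewrite subn0 subnn !expr0 bin0 binn mulr1 mul1r !mulr1n big1 ?addr0 // => i.
  rewrite -!val_eqE /= -lt0n => /andP[i_gt0 i_neqp].
  have /dvdnP[k ->] : (p %| 'C(p, i))%N.
    by apply: prime_dvd_bin => //; rewrite i_gt0 ltn_neqAle i_neqp -ltnS ltn_ord.
  by rewrite mulrnA -mulr_natr charR mulr0.
elim: s => [|s IHs]; first by rewrite expn0 !expr1.
by rewrite expnSr !exprM IHs addp.
Qed.

Lemma expr_sum_char (n : nat) (F : 'I_n -> R) s :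
  (\sum_(i < n) F i) ^+ (p ^ s) = \sum_(i < n) F i ^+ (p ^ s).
Proof.
apply: (big_morph (fun x => x ^+ (p ^ s))); first by move=> x y; apply: exprD_char.
by rewrite expr0n expn_eq0 eqn0Ngt prime_gt0.
Qed.

End FrobeniusPower.

(** The Frobenius power, written I^[q]. *)
Definition frob (R : comPzRingType) (q : nat) (I : set R) : set R :=
  ideal_span [set u ^+ q | u in I].

Lemma frob_ideal (R : comPzRingType) q (I : set R) : is_ideal (frob q I).
Proof. exact: ideal_span_ideal. Qed.

Lemma frob_mem (R : comPzRingType) q (I : set R) u : I u -> frob q I (u ^+ q).
Proof. by move=> Iu; apply: sub_ideal_span; exists u. Qed.

Lemma frob_sub (R : comPzRingType) q (I K : set R) :
  is_ideal K -> (forall u, I u -> K (u ^+ q)) -> frob q I `<=` K.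
Proof. by move=> iK h; apply: ideal_span_sub => // _ [u Iu <-]; apply: h. Qed.

Lemma frob_mono (R : comPzRingType) q (I J : set R) :
  I `<=` J -> frob q I `<=` frob q J.
Proof.
by move=> IJ; apply: frob_sub; [apply: frob_ideal|move=> u /IJ; apply: frob_mem].
Qed.

Lemma preimage_ideal (R L : comPzRingType) (phi : {rmorphism R -> L}) (I : set L) :
  is_ideal I -> is_ideal [set a | I (phi a)].
Proof.
move=> iI; split=> [|a b|a b] /=; rewrite ?rmorph0 ?rmorphD ?rmorphM.
- exact: ideal_zero.
- exact: ideal_add.
- exact: ideal_mull.
Qed.

(** * The ideals I_s(f) over a ring that is free over its p-th powers *)

Section FreeCase.
Variables (p : nat) (L : comPzRingType).
Hypotheses (p_prime : prime p) (charL : p%:R = 0 :> L).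
Hypothesis redL : forall (a : L) n, a ^+ n = 0 -> a = 0.
Implicit Types (I J B : set L).

Lemma expn_prime_gt0 s : (0 < p ^ s)%N. Proof. by rewrite expn_gt0 prime_gt0. Qed.

Lemma exprB_char (a b : L) s : (a - b) ^+ (p ^ s) = a ^+ (p ^ s) - b ^+ (p ^ s).
Proof. by have := exprD_char p_prime charL (a - b) b s; rewrite subrK => ->; rewrite addrK. Qed.

Lemma generates_roots s n (e : 'I_n -> L) : generates_over (qth_powers (p ^ s)) e ->
  forall a, exists v, a = \sum_(i < n) v i ^+ (p ^ s) * e i.
Proof.
move=> gen a; have [b bq ->] := gen a.
have [v vb] : {v & forall i, v i ^+ (p ^ s) = b i}.
  by apply: (@choice _ _ (fun i v => v ^+ (p ^ s) = b i)) => i; have [v _ vb] := bq i; exists v.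
by exists v; apply: eq_bigr => i _; rewrite vb.
Qed.

(** Writing the products of ring elements with the generators [e] in terms of
    [e] again shows that the elements with coordinates in q-th powers of [B]
    form an ideal. *)
Lemma frob_coordinates s n (e : 'I_n -> L) B h :
  generates_over (qth_powers (p ^ s)) e -> is_ideal B -> frob (p ^ s) B h ->
  exists2 c : 'I_n -> L, (forall i, B (c i)) & h = \sum_(i < n) c i ^+ (p ^ s) * e i.
Proof.
move=> /generates_roots gen iB.
pose K : set L := [set h | exists2 c : 'I_n -> L, (forall i, B (c i))
  & h = \sum_(i < n) c i ^+ (p ^ s) * e i].
suff : frob (p ^ s) B `<=` K by apply.
have iK : is_ideal K.
  split=> [|_ _ [c Bc ->] [d Bd ->]|a _ [c Bc ->]].
  - exists (fun=> 0); first by move=> _; apply: ideal_zero.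
    by rewrite big1 // => i _; rewrite expr0n eqn0Ngt expn_prime_gt0 mul0r.
  - exists (fun i => c i + d i); first by move=> i; apply: ideal_add.
    by rewrite -big_split; apply: eq_bigr => i _; rewrite (exprD_char p_prime charL) mulrDl.
  - have /choice[v vP] (i : 'I_n) := gen (a * e i).
    exists (fun j => \sum_(i < n) c i * v i j).
      by move=> j; apply: ideal_sum => // i; apply: ideal_mulr.
    rewrite mulr_sumr; under eq_bigr => i _ do rewrite mulrCA vP mulr_sumr.
    rewrite exchange_big /=; apply: eq_bigr => j _.
    rewrite (expr_sum_char p_prime charL) mulr_suml; apply: eq_bigr => i _.
    by rewrite exprMn mulrA.
apply: frob_sub => // u Bu; rewrite -[u ^+ _]mulr1; have [v ->] := gen 1.
exists (fun i => u * v i); first by move=> i; apply: ideal_mulr.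
by rewrite mulr_sumr; apply: eq_bigr => i _; rewrite exprMn mulrA.
Qed.

(** Two expressions of [h] in the same basis have the same coordinates, and
    q-th roots are unique in a reduced ring. *)
Lemma I_free_min s (h a : L) B :
  I_free p s h a -> is_ideal B -> frob (p ^ s) B h -> B a.
Proof.
case=> n [e [c [[gen ind] hE ca]]] iB hB.
have [d Bd hE'] := frob_coordinates gen iB hB.
suff cd i : c i = d i by move: a ca; apply/ideal_genP => // i; rewrite cd.
apply/eqP; rewrite -subr_eq0; apply/eqP; apply: (@redL _ (p ^ s)).
move: i; apply: (ind (fun i => (c i - d i) ^+ (p ^ s))); first by move=> i; exists (c i - d i).
under eq_bigr => i _ do rewrite exprB_char mulrBl.
by rewrite sumrB -hE -hE' subrr.
Qed.

Lemma I_free_mul s (h a g : L) : I_free p s h a -> I_free p s (g ^+ (p ^ s) * h) (g * a).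
Proof.
case=> n [e [c [be -> [b ->]]]]; exists n, e, (fun i => g * c i); split=> //.
  by rewrite mulr_sumr; apply: eq_bigr => i _; rewrite exprMn mulrA.
by exists b; rewrite mulr_sumr; apply: eq_bigr => i _; rewrite mulrCA.
Qed.

(** Together with [I_free_min]: [I_free p s h] is the smallest ideal whose
    Frobenius power contains [h]. *)
Lemma I_free_root s (h : L) : free_over (@qth_powers L (p ^ s)) ->
  is_ideal (I_free p s h) /\ frob (p ^ s) (I_free p s h) h.
Proof.
case=> n [e be]; have [c hE] := generates_roots be.1 h.
have igc := ideal_gen_is_ideal c.
have frobh I : is_ideal I -> (forall i, I (c i)) -> frob (p ^ s) I h.
  move=> iI Ic; rewrite hE; apply: (ideal_sum (frob_ideal _ _)).
  by move=> i; apply: (ideal_mulr _ (frob_ideal _ _)); apply: frob_mem.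
suff -> : I_free p s h = ideal_gen c by split; last exact: frobh igc (ideal_gen_mem c).
apply/seteqP; split=> [a ha|a ca]; last by exists n, e, c.
by apply: (I_free_min ha igc); apply: frobh igc (ideal_gen_mem c).
Qed.

(** As L is reduced, Frobenius is an isomorphism from L onto L^p, so L^q has the
    basis e_i^q over L^(pq); its products with a basis of L over L^q form a basis
    of L over L^(pq). *)
Lemma free_over_pth s : free_over (@qth_powers L p) -> free_over (@qth_powers L (p ^ s)).
Proof.
case=> n [e [gen ind]]; elim: s => [|s [m [e' [gen' ind']]]].
  exists 1%N, (fun=> 1); split=> [r|b _].
    by exists (fun=> r); [move=> i; exists r|rewrite big_ord1 mulr1].
  by rewrite big_ord1 mulr1 => b0 i; rewrite (ord1 i).
have {}gen : forall a, exists v, a = \sum_(i < n) v i ^+ p * e i.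
  by move=> a; have := @generates_roots 1 n e; rewrite expn1; apply.
have sumE (F : 'I_m -> 'I_n -> L) :
    \sum_(k < #|{: 'I_m * 'I_n}|) F (enum_val k).1 (enum_val k).2 *
      (e (enum_val k).2 ^+ (p ^ s) * e' (enum_val k).1)
    = \sum_(j < m) (\sum_(i < n) F j i * e i ^+ (p ^ s)) * e' j.
  rewrite -(big_enum_val (fun x : 'I_m * 'I_n => F x.1 x.2 * (e x.2 ^+ (p ^ s) * e' x.1))).
  rewrite -(pair_big xpredT xpredT (fun j i => F j i * (e i ^+ (p ^ s) * e' j))) /=.
  by apply: eq_bigr => j _; rewrite mulr_suml; apply: eq_bigr => i _; rewrite mulrA.
have powE (v : 'I_m -> 'I_n -> L) j :
    \sum_(i < n) v j i ^+ (p ^ s.+1) * e i ^+ (p ^ s)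
    = (\sum_(i < n) v j i ^+ p * e i) ^+ (p ^ s).
  rewrite (expr_sum_char p_prime charL); apply: eq_bigr => i _.
  by rewrite exprMn -exprM expnS.
exists #|{: 'I_m * 'I_n}|, (fun k => e (enum_val k).2 ^+ (p ^ s) * e' (enum_val k).1).
split=> [r|b bq b0].
  have [w rE] := generates_roots gen' r.
  have /choice[v vP] (j : 'I_m) := gen (w j).
  exists (fun k => v (enum_val k).1 (enum_val k).2 ^+ (p ^ s.+1)).
    by move=> k; exists (v (enum_val k).1 (enum_val k).2).
  rewrite (sumE (fun j i => v j i ^+ (p ^ s.+1))) rE.
  by apply: eq_bigr => j _; rewrite powE -vP.
have [v vb] : {v & forall k, v k ^+ (p ^ s.+1) = b k}.
  by apply: (@choice _ _ (fun k v => v ^+ (p ^ s.+1) = b k)) => k; have [v _ vb] := bq k; exists v.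
pose V j i := v (enum_rank (j, i)).
have bE k : b k = V (enum_val k).1 (enum_val k).2 ^+ (p ^ s.+1).
  by rewrite /V -surjective_pairing enum_valK vb.
have {}b0 : \sum_(j < m) (\sum_(i < n) V j i ^+ p * e i) ^+ (p ^ s) * e' j = 0.
  rewrite -[RHS]b0; under [RHS]eq_bigr => k _ do rewrite bE.
  by rewrite (sumE (fun j i => V j i ^+ (p ^ s.+1))); apply: eq_bigr => j _; rewrite powE.
move=> k; rewrite bE expnS exprM (_ : _ ^+ p = 0); last first.
  move: (enum_val k).1 (enum_val k).2 => j i.
  apply: (ind (fun i => V j i ^+ p)); first by move=> i'; exists (V j i').
  apply: (@redL _ (p ^ s)); move: j.
  by apply: (ind' _ _ b0) => j; eexists.
by rewrite expr0n eqn0Ngt expn_prime_gt0.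
Qed.

End FreeCase.

(** * Inverting one element *)

Section Extension.
Variables (R L : comPzRingType) (phi : {rmorphism R -> L}) (r : R).
Hypothesis loc : is_localization (powers_of r) phi.
Implicit Types (b : set R).

(** The ideal of L generated by the image of [b]. *)
Definition ext b : set L := [set y | exists n z, b z /\ y * phi r ^+ n = phi z].

Lemma loc_numerator y : exists n z, y * phi r ^+ n = phi z.
Proof.
by case: loc => _ /(_ y) [a [_ [[n _ <-] E]]] _; exists n, a; rewrite -E rmorphXn.
Qed.

Lemma ext_ideal b : is_ideal b -> is_ideal (ext b).
Proof.
move=> ib; split=> [|y y' [n [z [bz E]]] [n' [z' [bz' E']]]|a y [n [z [bz E]]]].
- by exists 0%N, 0; rewrite rmorph0 mul0r; split=> //; apply: ideal_zero.
- exists (n + n')%N, (z * r ^+ n' + z' * r ^+ n).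
  split; first by apply: ideal_add => //; apply: ideal_mulr.
  by rewrite rmorphD !rmorphM !rmorphXn -E -E' exprD; ring.
- have [m [a' E']] := loc_numerator a.
  exists (m + n)%N, (a' * z); split; first exact: ideal_mull.
  by rewrite rmorphM -E -E' exprD; ring.
Qed.

Lemma ext_phi b a : is_ideal b -> ext b (phi a) -> exists n, b (r ^+ n * a).
Proof.
move=> ib [n [z [bz E]]]; case: loc => _ _ ker.
have [|_ [k _ <-] rk0] := ker (r ^+ n * a - z).
  by rewrite rmorphB rmorphM rmorphXn -E mulrC subrr.
exists (k + n)%N; have -> : r ^+ (k + n) * a = r ^+ k * (r ^+ n * a - z) + r ^+ k * z.
  by rewrite exprD; ring.
by rewrite rk0 add0r; apply: ideal_mull.
Qed.

Lemma frob_phi q b a : is_ideal b -> frob q b a -> frob q (ext b) (phi a).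
Proof.
move=> ib; apply: (@frob_sub _ _ _ [set a | frob q (ext b) (phi a)]).
  exact: preimage_ideal (frob_ideal _ _).
move=> u bu /=; rewrite rmorphXn; apply: frob_mem.
by exists 0%N, u; rewrite expr0 mulr1.
Qed.

Lemma frob_ext q b : frob q (ext b) `<=` ext (frob q b).
Proof.
apply: frob_sub; first exact: ext_ideal (frob_ideal _ _).
move=> u [n [z [bz E]]]; exists (n * q)%N, (z ^+ q); split; first exact: frob_mem.
by rewrite rmorphXn -E exprMn exprM.
Qed.

Lemma loc_reduced : (forall (a : R) n, a ^+ n = 0 -> a = 0) ->
  forall (y : L) n, y ^+ n = 0 -> y = 0.
Proof.
move=> redR y n yn0; have [m [z E]] := loc_numerator y; case: loc => inv _ ker.
have yn1 : y ^+ n.+1 = 0 by rewrite exprS yn0 mulr0.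
have [|_ [k _ <-] rk0] := ker (z ^+ n.+1); first by rewrite rmorphXn -E exprMn yn1 mul0r.
have rz0 : r ^+ k * z = 0.
  by apply: (redR _ n.+1); rewrite exprMn exprS -mulrA mulrCA rk0 mulr0.
have [|t rt] := inv (r ^+ (k + m)); first by exists (k + m)%N.
have : y * phi (r ^+ (k + m)) = 0.
  by rewrite exprD rmorphM mulrCA [phi (r ^+ m)]rmorphXn E -rmorphM rz0 rmorph0.
by move=> yr0; rewrite -[y]mulr1 -rt mulrA yr0 mul0r.
Qed.

End Extension.

(** * The ideals I_s(f) in general *)

Definition locally_free_over_pth (p : nat) (R : comPzRingType) : Prop :=
  exists (k : nat) (r : 'I_k -> R), spec_cover r /\
    forall i, exists (L : comPzRingType) (phi : {rmorphism R -> L}),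
      is_localization (powers_of (r i)) phi /\ free_over (@qth_powers L p).

Section Global.
Variables (p : nat) (R : comPzRingType).
Hypotheses (p_prime : prime p) (charR : p%:R = 0 :> R).
Hypothesis redR : forall (a : R) n, a ^+ n = 0 -> a = 0.
Hypothesis noethR : noetherian R.
Implicit Types (b : set R).

Lemma char_codomain (L : comPzRingType) (phi : {rmorphism R -> L}) : p%:R = 0 :> L.
Proof. by rewrite -(rmorph_nat phi) charR rmorph0. Qed.

(** Otherwise the elements multiplying [a] into [b] would lie in a prime, which
    some [r i] avoids. *)
Lemma spec_cover_local k (r : 'I_k -> R) b a : spec_cover r -> is_ideal b ->
  (forall i, exists n, b (r i ^+ n * a)) -> b a.
Proof.
move=> rcov ib loc.
pose I : set R := [set x | b (x * a)].
have iI : is_ideal I.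
  split; rewrite /I /=; first by rewrite mul0r; apply: ideal_zero.
    by move=> x y ? ?; rewrite mulrDl; apply: ideal_add.
  by move=> x y ?; rewrite -mulrA; apply: ideal_mull.
have [I1|nI1] := pselect (I 1); first by rewrite -[a]mul1r.
have [P [_ [hP IP _ _]]] := minimal_prime noethR iI nI1.
have [i nPi] := rcov P hP; case: nPi; have [n bn] := loc i.
by apply: (prime_exp (n := n) hP); apply: IP.
Qed.

Lemma I_min s (f a : R) b : I_ p s f a -> is_ideal b -> frob (p ^ s) b f -> b a.
Proof.
case=> k [r [rcov hr]] ib bf; apply: (spec_cover_local rcov ib) => i.
have [L [phi [loc _ Ia]]] := hr i.
apply: (ext_phi loc ib); apply: (I_free_min p_prime (char_codomain phi) _ Ia).
- exact: loc_reduced loc redR.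
- exact: ext_ideal.
- exact: frob_phi.
Qed.

(** Multiplying by g^q multiplies every root c_i by g. *)
Lemma I_mul s (h a g : R) : I_ p s h a -> I_ p s (g ^+ (p ^ s) * h) (g * a).
Proof.
case=> k [r [rcov hr]]; exists k, r; split=> // i.
have [L [phi [loc fr Ia]]] := hr i; exists L, phi; split=> //.
by rewrite !rmorphM rmorphXn; apply: I_free_mul.
Qed.

(** The glued ideal [b] consists of the elements whose image in every L i lies in
    the local ideal [B i].  To see that [f] lies in its Frobenius power, one needs
    that [B i] is generated by elements of [b], that is, that [B i] comes from
    the contraction [b_ j] of [B j] for every j.  After multiplication by a power
    of r j, [f] lies in the Frobenius power of [b_ j]; minimality of [B i]
    then gives this up to a power of r j, which [b_ j] absorbs because r j is
    invertible in L j. *)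
Lemma I_root s (f : R) : locally_free_over_pth p R ->
  is_ideal (I_ p s f) /\ frob (p ^ s) (I_ p s f) f.
Proof.
case=> k [r [rcov hr]]; set q := (p ^ s)%N.
have [X XP] : {X : 'I_k -> {L : comPzRingType & {rmorphism R -> L}} & forall i,
    is_localization (powers_of (r i)) (projT2 (X i))
    /\ free_over (@qth_powers (projT1 (X i)) p)}.
  apply: (@choice _ _ (fun i (X : {L : comPzRingType & {rmorphism R -> L}}) =>
    is_localization (powers_of (r i)) (projT2 X) /\ free_over (@qth_powers (projT1 X) p))).
  by move=> i; have [L [phi h]] := hr i; exists (existT _ L phi).
pose L i := projT1 (X i); pose phi i : {rmorphism R -> L i} := projT2 (X i).
have loc i : is_localization (powers_of (r i)) (phi i) by case: (XP i).
have charL i := char_codomain (phi i).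
have redL i := loc_reduced (loc i) redR.
have free i : free_over (@qth_powers (L i) q).
  by apply: free_over_pth => //; [exact: redL|case: (XP i)].
pose B i := I_free p s (phi i f).
have BP i : is_ideal (B i) /\ frob q (B i) (phi i f).
  exact: (I_free_root p_prime (charL i) (redL i)).
have iB i := (BP i).1.
pose b_ i : set R := [set a | B i (phi i a)].
have ib_ i : is_ideal (b_ i) by apply: preimage_ideal.
pose b : set R := [set a | forall i, b_ i a].
have ib : is_ideal b.
  split=> [i|x y bx by_ i|x y by_ i]; first exact: ideal_zero.
    by apply: ideal_add; [exact: ib_|exact: bx|exact: by_].
  by apply: ideal_mull; [exact: ib_|exact: by_].
(* The exponent is taken as a multiple of q so that it has a q-th root. *)
have cover_power j : exists M, frob q (b_ j) (r j ^+ (M * q) * f).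
  have [M hM] : exists n, frob q (b_ j) (r j ^+ n * f).
    apply: (ext_phi (loc j)); first exact: frob_ideal.
    apply: (frob_ext (loc j)); apply: frob_mono (BP j).2 => y By.
    have [n [z E]] := loc_numerator (loc j) y; exists n, z; split=> //.
    by rewrite /b_ /= -E; apply: (ideal_mulr _ (iB j)).
  exists M; apply: (ideal_mulexp (frob_ideal _ _) _ hM).
  by rewrite leq_pmulr // /q expn_gt0 prime_gt0.
have BE i j : B i `<=` ext (phi i) (r i) (b_ j).
  move=> y By; have [M hM] := cover_power j.
  have iE := ext_ideal (loc i) (ib_ j).
  have gE : ext (phi i) (r i) (b_ j) (phi i (r j ^+ M) * y).
    apply: (I_free_min p_prime (charL i) (redL i) (I_free_mul _ By) iE).
    by rewrite -rmorphXn -rmorphM -exprM; apply: frob_phi.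
  have [n [z yz]] := loc_numerator (loc i) y.
  have [m] : exists m, b_ j (r i ^+ m * (r j ^+ M * z)).
    apply: (ext_phi (loc i) (ib_ j)).
    by rewrite rmorphM -yz mulrA; apply: (ideal_mulr _ iE).
  rewrite /b_ /= mulrCA rmorphM => h.
  exists (n + m)%N, (r i ^+ m * z); split.
    have [inv _ _] := loc j; have [|t rt] := inv (r j ^+ M); first by exists M.
    rewrite /b_ /= -[phi j _]mul1r -rt mulrAC mulrC.
    exact: (ideal_mull _ (iB j)).
  by rewrite rmorphM -yz rmorphXn exprD; ring.
have Bb i : B i `<=` ext (phi i) (r i) b.
  move=> y By; have [n [z yz]] := loc_numerator (loc i) y.
  have /choice[m mP] (j : 'I_k) : exists m, b_ j (r i ^+ m * z).
    apply: (ext_phi (loc i) (ib_ j)); apply: (BE i j).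
    by rewrite -yz; apply: (ideal_mulr _ (iB i)).
  exists (n + \max_(j < k) m j)%N, (r i ^+ (\max_(j < k) m j) * z); split.
    by move=> j; apply: (ideal_mulexp (ib_ j) _ (mP j)); apply: leq_bigmax.
  by rewrite rmorphM -yz rmorphXn exprD; ring.
have bf : frob q b f.
  apply: (spec_cover_local rcov (frob_ideal _ _)) => i.
  apply: (ext_phi (loc i) (frob_ideal _ _)); apply: (frob_ext (loc i)).
  exact: frob_mono (Bb i) _ (BP i).2.
suff -> : I_ p s f = b by [].
apply/seteqP; split=> [a Ia|a ba]; first exact: I_min Ia ib bf.
exists k, r; split=> // i; exists (L i), (phi i); split=> //; last exact: ba.
by case: (XP i).
Qed.

Lemma I_chain_descends s (f : R) : locally_free_over_pth p R ->
  I_ p s.+1 (f ^+ (p ^ s.+1 - 1)) `<=` I_ p s (f ^+ (p ^ s - 1)).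
Proof.
move=> lf a Ia; have [iI hI] := I_root s (f ^+ (p ^ s - 1)) lf.
apply: (I_min Ia iI).
have -> : f ^+ (p ^ s.+1 - 1) = f ^+ (p - 1) * (f ^+ (p ^ s - 1)) ^+ p.
  rewrite -exprM -exprD; congr (_ ^+ _).
  rewrite mulnBl mul1n -expnSr addnC addnBA ?prime_gt0 // subnK //.
  by rewrite expnS leq_pmulr // expn_gt0 prime_gt0.
apply: (ideal_mull _ (frob_ideal _ _)); move: hI.
pose K : set R := [set x | frob (p ^ s.+1) (I_ p s (f ^+ (p ^ s - 1))) (x ^+ p)].
suff iK : is_ideal K.
  move=> hI; suff : K (f ^+ (p ^ s - 1)) by [].
  move: hI; apply: frob_sub => // u Iu; rewrite /K /= -exprM -expnSr.
  exact: frob_mem.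
split; rewrite /K /=.
- by rewrite expr0n eqn0Ngt prime_gt0 //; apply: ideal_zero (frob_ideal _ _).
- move=> x y; have := exprD_char p_prime charR x y 1; rewrite expn1 => ->.
  exact: ideal_add (frob_ideal _ _).
- by move=> x y; rewrite exprMn; apply: (ideal_mull _ (frob_ideal _ _)).
Qed.

(** When R is locally free over R^p, this is the ideal generated by the
    psi(f^(p-1) y), for y in [X] and psi a p^(-1)-linear map from R to R. *)
Definition cartier_image (f : R) (X : set R) : set R :=
  ideal_span [set a | exists2 y, X y & I_ p 1 (f ^+ (p - 1) * y) a].

(** For the inclusion from right to left, f^(p-1) y lies in I_(s+1)^[p] for y in
    I_s: by [I_mul] it lies in I_s(f^(p^(s+1) - 1)), which minimality compares with
    I_(s+1)^[p].  The other inclusion only composes Frobenius powers. *)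
Lemma I_succ s (f : R) : locally_free_over_pth p R ->
  I_ p s.+1 (f ^+ (p ^ s.+1 - 1)) = cartier_image f (I_ p s (f ^+ (p ^ s - 1))).
Proof.
move=> lf; set h := f ^+ (p ^ s - 1).
have hE : f ^+ (p ^ s.+1 - 1) = (f ^+ (p - 1)) ^+ (p ^ s) * h.
  rewrite -exprM -exprD; congr (_ ^+ _).
  rewrite mulnBl mul1n -expnS addnBA ?expn_gt0 ?prime_gt0 // subnK //.
  by rewrite leq_pexp2l ?prime_gt0.
have [iI hI] := I_root s h lf.
have [iI' hI'] := I_root s.+1 (f ^+ (p ^ s.+1 - 1)) lf.
apply/seteqP; split=> a.
  move=> Ia; apply: (I_min Ia (ideal_span_ideal _)); rewrite hE; move: hI.
  pose K : set R := [set x | frob (p ^ s.+1) (cartier_image f (I_ p s h))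
                               ((f ^+ (p - 1)) ^+ (p ^ s) * x)].
  suff : frob (p ^ s) (I_ p s h) `<=` K by apply.
  have iF := frob_ideal (p ^ s.+1) (cartier_image f (I_ p s h)).
  apply: frob_sub.
    split; rewrite /K /=; first by rewrite mulr0; apply: ideal_zero iF.
      by move=> x y; rewrite mulrDr; apply: ideal_add iF.
    by move=> x y; rewrite mulrCA; apply: (ideal_mull _ iF).
  move=> u Iu; rewrite /K /= -exprMn.
  have [iJ hJ] := I_root 1 (f ^+ (p - 1) * u) lf.
  move: hJ; set g := _ * u => hJ.
  pose K' : set R := [set x | frob (p ^ s.+1) (cartier_image f (I_ p s h)) (x ^+ (p ^ s))].
  suff : frob (p ^ 1) (I_ p 1 g) `<=` K' by apply.
  apply: frob_sub.
    split; rewrite /K' /=.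
    - by rewrite expr0n expn_eq0 eqn0Ngt prime_gt0 //; apply: ideal_zero iF.
    - by move=> x y; rewrite (exprD_char p_prime charR); apply: ideal_add iF.
    - by move=> x y; rewrite exprMn; apply: (ideal_mull _ iF).
  move=> v Iv; rewrite /K' /= -exprM -expnD; apply: frob_mem.
  by apply: sub_ideal_span; exists u.
apply: ideal_span_sub => // {}a [y Iy]; move=> Ia; apply: (I_min Ia iI').
have := I_mul (f ^+ (p - 1)) Iy; rewrite -hE => Iy'.
apply: (I_min Iy' (frob_ideal _ _)); move: hI'; apply: frob_sub.
  exact: frob_ideal.
move=> u Iu; have -> : u ^+ (p ^ s.+1) = (u ^+ p) ^+ (p ^ s) by rewrite expnS exprM.
by apply: frob_mem; rewrite expn1; apply: frob_mem.
Qed.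

Lemma cartier_image_mono f X Y :
  X `<=` Y -> cartier_image f X `<=` cartier_image f Y.
Proof. by move=> XY; apply: ideal_span_mono => a [y /XY Yy ?]; exists y. Qed.

Lemma cartier_image_mul f X x a :
  cartier_image f X a -> cartier_image f [set x ^+ p * y | y in X] (x * a).
Proof.
set Y := [set _ | _ in X].
have iC : is_ideal (cartier_image f Y) by apply: ideal_span_ideal.
suff : cartier_image f X `<=` [set a | cartier_image f Y (x * a)] by apply.
apply: ideal_span_sub.
  split=> [|b c|b c] /=; rewrite ?mulr0 ?mulrDr 1?mulrCA.
  - exact: ideal_zero iC.
  - exact: ideal_add iC.
  - exact: (ideal_mull _ iC).
move=> b [y Xy Ib]; apply: sub_ideal_span; exists (x ^+ p * y); first by exists y.
by have := I_mul x Ib; rewrite expn1 mulrCA.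
Qed.

End Global.

Theorem corollary4p2 (p : nat) (A : comNzRingType) (R : comPzRingType)
    (phi : {rmorphism A -> R}) (f : R)
    (charA : p \in [pchar A])
    (regA : regular_local A)
    (FfinA : F_finite A p)
    (fgR : fg_algebra phi)
    (regR : regular_ring R) :
  (forall s : nat, (1 <= s)%N ->
     I_ p s.+1 (f ^+ (p ^ s.+1 - 1)) `<=` I_ p s (f ^+ (p ^ s - 1))) /\
  (exists N : nat, (1 <= N)%N /\
     forall s : nat, (N <= s)%N ->
       I_ p s (f ^+ (p ^ s - 1)) = I_ p N (f ^+ (p ^ N - 1))).
Proof.
have p_prime := pcharf_prime charA.
have charR : p%:R = 0 :> R by rewrite -(rmorph_nat phi) (pcharf0 charA) rmorph0.
have redR := regular_reduced regR; have [noethR _] := regR.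
(* Without a cover as required in its definition, I_s is the empty set. *)
have [lf|nlf] := pselect (locally_free_over_pth p R); last first.
  have I0 s (g : R) : I_ p s g = set0.
    apply/seteqP; split=> // a [k [r [rcov hr]]]; apply: nlf; exists k, r; split=> // i.
    by have [L [psi [loc fr _]]] := hr i; exists L, psi.
  by split=> [s _|]; [rewrite !I0|exists 1%N; split=> // s _; rewrite !I0].
pose J s := I_ p s (f ^+ (p ^ s - 1)).
have Jdec s : J s.+1 `<=` J s by apply: I_chain_descends.
split=> [s _|]; first exact: Jdec.
have [N stop] := @cartier_chain_stops R noethR p (cartier_image p f) J
  (prime_gt1 p_prime) (@cartier_image_mono p R f)
  (@cartier_image_mul p R f) (fun s => (I_root p_prime charR redR noethR s _ lf).1)
  (fun s => I_succ p_prime charR redR noethR s f lf) Jdec.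
exists N.+1; split=> // s; elim: s => [//|s IHs]; rewrite leq_eqVlt => /orP[/eqP <- //|lt_Ns].
rewrite -IHs //; apply/seteqP; split; first exact: Jdec.
by apply: stop; apply: ltnW.
Qed.
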